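(* Let $\mathbf{k}$ be an algebraically closed field of characteristic $0$, let $P$ be a basic symmetric indecomposable finite-dimensional associative $\mathbf{k}$-algebra, let $1=e_1+\cdots+e_k$ be a decomposition of the unity into mutually orthogonal primitive idempotents, and let $\phi$ be a symmetric linear function on $P$ such that $\langle a,b\rangle=\phi(ab)$ is a nondegenerate bilinear form on $P$ and $\phi(e_i)=0$ for all $1\le i\le k$. Let $W$ be a finitely generated projective right $P$-module. Then $\phi_{W}=\mathrm{tr}_{W}^{\phi}$ as linear functions on $\mathrm{End}_P(W)$, where $\phi_W$ and the pseudotrace map $\mathrm{tr}_W^\phi$ are defined in the context.
   Context: A linear function $\phi:P\to\mathbf{k}$ is symmetric if $\phi(ab)=\phi(ba)$ for all $a,b\in P$. $J(P)$ is the Jacobson radical. Since $P$ is basic, $P/J(P)=\mathbf{k}\bar e_1\oplus\cdots\oplus\mathbf{k}\bar e_k$, and $\{e_iP\}_{i=1}^k$ is the complete list of indecomposable projective right $P$-modules. The left and right socles of $P$ coincide and form a two-sided ideal $\mathrm{Soc}(P)=J(P)^{\perp}$ (orthogonal with respect to $\langle a,b\rangle=\phi(ab)$), so $\langle\ ,\ \rangle$ induces a nondegenerate pairing $\mathrm{Soc}(P)\times P/J(P)\to\mathbf{k}$; $\{f_1,\dots,f_k\}$ denotes the basis of $\mathrm{Soc}(P)$ dual to $\{\bar e_1,\dots,\bar e_k\}$, i.e. $\langle f_i,e_j\rangle=\delta_{ij}$. Put $d_{ij}=\dim_{\mathbf{k}} e_iJ(P)e_j/e_i\mathrm{Soc}(P)e_j$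 (one has $d_{ij}=d_{ji}$). Fix a basis $\Omega=\{\rho_0^{ii},\rho_{d_{ii}+1}^{ii},\rho_{s}^{ij}\mid 1\le i,j\le k,\ 1\le s\le d_{ij}\}$ of $P$ satisfying: (a) $\rho_0^{ii}=e_i$ and $\rho_{d_{ii}+1}^{ii}=f_i$; (b) $e_i\rho_s^{ij}e_j=\rho_s^{ij}$; (c) $\langle\rho_s^{ij},\rho_{d_{ab}+1-t}^{ab}\rangle=\delta_{i,b}\delta_{j,a}\delta_{s,t}$; (d) $\rho_s^{ij}\rho_{d_{ji}+1-s}^{ji}=f_i$; (e) the span of $\{\rho_t^{ij}\mid t\ge s\}$ is $e_iPe_i$-invariant. (Such a basis is provided by a lemma of Miyamoto.) Let $\Omega_{ij}=\{\rho^{ij}_s\mid s\}$ (all admissible $s$) and $\Omega_i=\bigcup_{j}\Omega_{ij}$, a basis of $e_iP$. Definition of $\mathrm{tr}_W^\phi$: fix an isomorphism $W\cong\bigoplus_{i=1}^k n_i\,e_iP$ ($n_i$ copies of $e_iP$; $n_i=\dim_{\mathbf{k}}Wf_i$), and for $1\le j\le n_i$ let $v_j^{e_i}\in W$ correspond to $e_i$ in the $j$-th copy of $e_iP$. Then $\{v_j^{e_i}\rho\mid\rho\in\Omega_i,\ 1\le i\le k,\ 1\le j\le n_i\}$ is a basis of $W$. For $\alpha\in\mathrm{End}_P(W)$ one can write uniquely $\alpha(v_j^{e_i})=\sum_{s=1}^k\sum_{t=1}^{n_s}\sum_{\rho^{si}\in\Omega_{si}}\alpha_{jt}^{\rho^{si}}\,v_t^{e_s}\rho^{si}$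 with $\alpha_{jt}^{\rho^{si}}\in\mathbf{k}$. Define $\mathrm{tr}_W^\phi(\alpha)=\sum_{i=1}^k\sum_{j=1}^{n_i}\alpha_{jj}^{f_i}$. Definition of $\phi_W$: a $P$-coordinate system of $W$ consists of $\{u_i\}_{i=1}^n\subset W$ and $\{\alpha_i\}_{i=1}^n\subset\mathrm{Hom}_P(W,P)$ with $w=\sum_{i=1}^n u_i\alpha_i(w)$ for all $w\in W$; it exists since $W$ is finitely generated projective. Define $\phi_W(\alpha)=\phi\bigl(\sum_{i=1}^n\alpha_i(\alpha(u_i))\bigr)$ for $\alpha\in\mathrm{End}_P(W)$; this does not depend on the choice of coordinate system. *)

(* Defs.v *)
From HB Require Import structures.
From mathcomp Require Import all_boot all_order all_algebra all_field.
From Stdlib Require Import ClassicalEpsilon.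

Set Implicit Arguments.
Unset Strict Implicit.
Unset Printing Implicit Defensive.

Import GRing.Theory.
Local Open Scope ring_scope.

(* A right P-module is a left module over the converse ring P^c; [ract w x] is
   the right action w x.  P as a right module over itself is (P^c)^o. *)
Definition ract (P : nzRingType) (W : lmodType P^c) (w : W) (x : P) : W :=
  (x : P^c) *: w.

Definition fin_generated (P : nzRingType) (W : lmodType P^c) : Prop :=
  exists (N : nat) (u : 'I_N -> W),
    forall w, exists c : 'I_N -> P, w = \sum_(l < N) ract (u l) (c l).

Definition projective (P : nzRingType) (W : lmodType P^c) : Prop :=
  forall (A B : lmodType P^c) (g : {linear A -> B}) (h : {linear W -> B}),
    (forall y, exists x, g x = y) ->
    exists l : {linear W -> A}, forall w, g (l w) = h w.

Section Ideals.
Variables (F : fieldType) (P : falgType F).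
Implicit Types U V M : {vspace P}.

(* Since P is unital, one-sided and two-sided ideals are subspaces. *)
Definition right_ideal U : Prop := (U * fullv <= U)%VS.

Definition two_sided_ideal U : Prop :=
  (fullv * U <= U)%VS /\ (U * fullv <= U)%VS.

Definition maximal_right_ideal M : Prop :=
  [/\ right_ideal M, M <> fullv &
      forall V, right_ideal V -> (M <= V)%VS -> V = M \/ V = fullv].

Definition minimal_right_ideal M : Prop :=
  [/\ right_ideal M, M <> 0%VS &
      forall V, right_ideal V -> (V <= M)%VS -> V = 0%VS \/ V = M].

Lemma big_capv_exists (Q : {vspace P} -> Prop) :
  exists U, forall x, x \in U <-> (forall M, Q M -> x \in M).
Proof.
suff H : forall n U, (\dim U <= n)%N ->
    (forall x, (forall M, Q M -> x \in M) -> x \in U) ->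
    exists U, forall x, x \in U <-> (forall M, Q M -> x \in M).
  by apply: (H _ fullv (leqnn _)) => x _; rewrite memvf.
elim=> [|n IH] U leUn QU.
  exists U => x; split; last exact: QU.
  move: leUn; rewrite leqn0 dimv_eq0 => /eqP-> /[!memv0]/eqP-> M _.
  exact: mem0v.
have [subU|] := classic (forall M, Q M -> (U <= M)%VS).
  exists U => x; split; last exact: QU.
  by move=> xU M /subU/subvP; apply.
move=> /not_all_ex_not[M nQM].
have [QM nUM] : Q M /\ ~ (U <= M)%VS by apply: imply_to_and.
apply: (IH (U :&: M)%VS) => [|x Qx]; last by rewrite memv_cap QU ?Qx.
rewrite -ltnS (leq_trans _ leUn) // ltnNge; apply/negP => dimUM.
by apply: nUM; apply/capv_idPl/eqP; rewrite eqEdim capvSl.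
Qed.

Definition big_capv (Q : {vspace P} -> Prop) : {vspace P} :=
  sval (constructive_indefinite_description _ (big_capv_exists Q)).

Lemma big_capvP (Q : {vspace P} -> Prop) x :
  x \in big_capv Q <-> (forall M, Q M -> x \in M).
Proof. by rewrite /big_capv; case: constructive_indefinite_description. Qed.

Definition jacobson : {vspace P} := big_capv maximal_right_ideal.

(* The sum of all minimal right ideals, i.e. the smallest subspace containing
   them all. *)
Definition socle : {vspace P} :=
  big_capv (fun U => forall M, minimal_right_ideal M -> (M <= U)%VS).

Definition indecomposable_algebra : Prop :=
  forall I J, two_sided_ideal I -> two_sided_ideal J ->
    (I + J)%VS = fullv -> (I :&: J)%VS = 0%VS -> I = 0%VS \/ J = 0%VS.

Definition idempotent_elt (x : P) : Prop := x * x = x.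

Definition primitive_idempotent (x : P) : Prop :=
  [/\ idempotent_elt x, x <> 0 &
      forall y z, idempotent_elt y -> idempotent_elt z ->
        y * z = 0 -> z * y = 0 -> x = y + z -> y = 0 \/ z = 0].

Definition primitive_decomposition (k : nat) (e : 'I_k -> P) : Prop :=
  [/\ forall i, primitive_idempotent (e i),
      forall i j, i != j -> e i * e j = 0 &
      \sum_(i < k) e i = 1].

Definition symmetric_function (phi : {scalar P}) : Prop :=
  forall a b, phi (a * b) = phi (b * a).

(* Nondegeneracy of <a, b> = phi (a b); P being finite-dimensional, it is enough
   to consider one of the two kernels. *)
Definition nondegenerate_function (phi : {scalar P}) : Prop :=
  forall a, (forall b, phi (a * b) = 0) -> a = 0.

Definition symmetric_algebra : Prop :=
  exists phi : {scalar P}, symmetric_function phi /\ nondegenerate_function phi.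

End Ideals.

Arguments jacobson {F} P.
Arguments socle {F} P.
Arguments indecomposable_algebra {F} P.
Arguments symmetric_algebra {F} P.

(* The right ideal x P as a right P-module. *)
Section PrincipalRightIdeal.
Variables (F : fieldType) (P : falgType F) (x : P).

Definition mem_pideal : pred (P^c)^o :=
  fun y => (y : P) \in (<[x]> * fullv)%VS.

Fact mem_pideal_submod_closed : submod_closed mem_pideal.
Proof.
split=> [|a y z]; first exact: mem0v.
rewrite !unfold_in /mem_pideal => yx zx.
apply: (@memvD _ P _ ((y : P) * (a : P)) (z : P)) => //.
rewrite (subvP (_ : <[x]> * fullv * fullv <= _)%VS) ?memv_mul ?memvf //.
by rewrite -prodvA prodvSr ?subvf.
Qed.

HB.instance Definition _ :=
  GRing.isSubmodClosed.Build P^c (P^c)^o mem_pideal mem_pideal_submod_closed.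

Record pideal : predArgType :=
  PIdeal { pideal_val :> (P^c)^o; _ : mem_pideal pideal_val }.

HB.instance Definition _ := [isSub for pideal_val].
HB.instance Definition _ := [Choice of pideal by <:].
HB.instance Definition _ := [SubChoice_isSubLmodule of pideal by <:].

Fact pideal_gen_subproof : mem_pideal x.
Proof. by rewrite /mem_pideal -[x in x \in _]mulr1 memv_mul ?memv_line ?memvf. Qed.

Definition pideal_gen : pideal := PIdeal pideal_gen_subproof.

End PrincipalRightIdeal.

Definition isomorphic (R : nzRingType) (A B : lmodType R) : Prop :=
  exists g : {linear A -> B}, bijective g.

(* P is basic, with respect to a complete set e of primitive orthogonal
   idempotents: the modules e_i P are pairwise non-isomorphic (by Krull-Schmidt
   this does not depend on e). *)
Definition basic (F : fieldType) (P : falgType F) (k : nat) (e : 'I_k -> P) :=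
  forall i j, isomorphic (pideal (e i)) (pideal (e j)) -> i = j.

(* The right P-module \bigoplus_i n_i (e_i P), as the submodule of P-valued
   functions on {(i, j) | j < n_i} whose value at (i, j) lies in e_i P. *)
Section DirectSum.
Variables (F : fieldType) (P : falgType F).
Variables (k : nat) (e : 'I_k -> P) (n : 'I_k -> nat).

Let index := {i : 'I_k & 'I_(n i)}.

Definition mem_dsum : pred {ffun index -> (P^c)^o} :=
  fun y => [forall p : index, mem_pideal (e (tag p)) (y p)].

Fact mem_dsum_submod_closed : submod_closed mem_dsum.
Proof.
split=> [|a y z].
  by apply/forallP => p; rewrite ffunE; exact: mem0v.
move=> /forallP yS /forallP zS; apply/forallP => p; rewrite !ffunE.
exact: (mem_pideal_submod_closed (e (tag p))).2 (yS p) (zS p).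
Qed.

HB.instance Definition _ :=
  GRing.isSubmodClosed.Build P^c {ffun index -> (P^c)^o} mem_dsum
    mem_dsum_submod_closed.

Record dsum : predArgType :=
  DSum { dsum_val :> {ffun index -> (P^c)^o}; _ : mem_dsum dsum_val }.

HB.instance Definition _ := [isSub for dsum_val].
HB.instance Definition _ := [Choice of dsum by <:].
HB.instance Definition _ := [SubChoice_isSubLmodule of dsum by <:].

Definition dsum_gen_fun (p : index) : {ffun index -> (P^c)^o} :=
  [ffun q => if q == p then e (tag q) : (P^c)^o else 0].

Fact dsum_gen_subproof p : mem_dsum (dsum_gen_fun p).
Proof.
apply/forallP => q; rewrite ffunE; case: eqP => _.
  exact: pideal_gen_subproof.
exact: mem0v.
Qed.

(* e_i in the j-th copy of e_i P *)
Definition dsum_gen (i : 'I_k) (j : 'I_(n i)) : dsum :=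
  DSum (dsum_gen_subproof (Tagged (fun i => 'I_(n i)) j)).

End DirectSum.

Section Pseudotrace.
Variables (F : fieldType) (P : falgType F) (phi : {scalar P}).
Variables (k : nat) (e f : 'I_k -> P).

Record dual_socle_basis : Prop := DualSocleBasis {
  dual_socle_basisP : basis_of (socle P) [seq f i | i <- enum 'I_k];
  dual_socle_pairing : forall i j, phi (f i * e j) = (i == j)%:R }.

(* dim e_i J(P) e_j / e_i Soc(P) e_j *)
Definition cartan_dim (i j : 'I_k) : nat :=
  \dim ((<[e i]> * jacobson P * <[e j]>) :\: (<[e i]> * socle P * <[e j]>))%VS.

Local Notation d := cartan_dim.

(* The s for which rho_s^{ij} exists: 0 <= s <= d_ii + 1 if i = j and
   1 <= s <= d_ij otherwise. *)
Definition admissible (i j : 'I_k) : seq nat :=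
  if i == j then index_iota 0 (d i j).+2 else index_iota 1 (d i j).+1.

Variable rho : 'I_k -> 'I_k -> nat -> P.

Definition Omega : seq P :=
  [seq rho p.1 p.2 s | p <- enum {: 'I_k * 'I_k}, s <- admissible p.1 p.2].

Definition tail_span (i j : 'I_k) (s : nat) : {vspace P} :=
  <<[seq rho i j t | t <- admissible i j & (s <= t)%N]>>%VS.

Record adapted_basis : Prop := AdaptedBasis {
  adapted_basisP : basis_of fullv Omega;
  adapted_first : forall i, rho i i 0 = e i;
  adapted_last : forall i, rho i i (d i i).+1 = f i;
  adapted_corner : forall i j s, s \in admissible i j ->
    e i * rho i j s * e j = rho i j s;
  adapted_pairing : forall i j s a b t,
    s \in admissible i j -> t \in admissible a b ->
    phi (rho i j s * rho a b ((d a b).+1 - t)) =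
      ((i == b) && (j == a) && (s == t))%:R;
  adapted_mul : forall i j s, s \in admissible i j ->
    rho i j s * rho j i ((d j i).+1 - s) = f i;
  adapted_invariant : forall i j s,
    (<[e i]> * fullv * <[e i]> * tail_span i j s <= tail_span i j s)%VS }.

Variables (W : lmodType P^c) (n : 'I_k -> nat).

Definition coefficients := forall s : 'I_k, 'I_(n s) -> nat -> F.

(* c gives the coefficients alpha_{jt}^{rho^{si}_r} of
   w = alpha (v_j^{e_i}); c s t r is irrelevant for r \notin admissible s i. *)
Definition expansion (v : forall i, 'I_(n i) -> W) (i : 'I_k) (w : W)
    (c : coefficients) : Prop :=
  w = \sum_(s < k) \sum_(t < n s) \sum_(r <- admissible s i)
        ract (v s t) (c s t r *: rho s i r).

Definition coef_of (v : forall i, 'I_(n i) -> W) (i : 'I_k) (w : W) :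
    coefficients :=
  epsilon (inhabits (fun _ _ _ => 0)) (expansion v i w).

(* The isomorphism W ~ \bigoplus_i n_i (e_i P) is given as a map theta into W, so
   that v_j^{e_i} = theta (dsum_gen e j); recall that f_i = rho_{d_ii + 1}^{ii}. *)
Definition pseudotrace (theta : {linear dsum e n -> W})
    (alpha : {linear W -> W}) : F :=
  let v i j := theta (@dsum_gen F P k e n i j) in
  \sum_(i < k) \sum_(j < n i) coef_of v i (alpha (v i j)) j (d i i).+1.

Definition coordinate_system (N : nat) (u : 'I_N -> W)
    (a : 'I_N -> {linear W -> (P^c)^o}) : Prop :=
  forall w, w = \sum_(l < N) ract (u l) (a l w).

Definition phi_mod (N : nat) (u : 'I_N -> W)
    (a : 'I_N -> {linear W -> (P^c)^o}) (alpha : {linear W -> W}) : F :=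
  phi (\sum_(l < N) (a l (alpha (u l)) : P)).

End Pseudotrace.

(* Main.v *)
(* The value phi (sum_l a_l (alpha (u_l))) does not depend on the coordinate
   system (symmetry of phi), so it can be computed in the one given by the
   generators v_j^{e_i} and the coordinate projections of the direct sum of the
   e_i P.  The diagonal coordinate of alpha (v_j^{e_i}) lies in e_i P e_i, and
   pairing with rho_0^{ii} = e_i shows that phi vanishes on every basis element
   of e_i P e_i except f_i, where it is 1: phi picks out the f_i-coefficient. *)
From HB Require Import structures.
Require Import Defs.
From mathcomp Require Import all_boot all_order all_algebra all_field.
From Stdlib Require Import ClassicalEpsilon.

Local Open Scope ring_scope.

Import GRing.Theory.

Lemma sum_tag {V : nmodType} {I : finType} {J : I -> finType}
    (x : forall i, J i -> V) :
  \sum_i \sum_j x i j = \sum_(p : {i : I & J i}) x (tag p) (tagged p).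
Proof. exact: (sig_big_dep xpredT (fun=> xpredT)). Qed.

Section RightAction.
Context {P : nzRingType} {W : lmodType P^c}.

Lemma ract_sumr (w : W) {I : Type} (r : seq I) (x : I -> P) :
  ract w (\sum_(i <- r) x i) = \sum_(i <- r) ract w (x i).
Proof. exact: (scaler_suml w). Qed.

Lemma linear_ract {V : lmodType P^c} (g : {linear V -> W}) (v : V) (x : P) :
  g (ract v x) = ract (g v) x.
Proof. exact: linearZ. Qed.

End RightAction.

Lemma ract_regular {P : nzRingType} (y x : P) :
  ract (y : (P^c)^o) x = y * x.
Proof. by []. Qed.

(* Invariance of the trace under a change of coordinate system: expand [u l] in
   [v], move the coefficient [b p (u l)] across [phi], resum over [l]. *)
Lemma phi_mod_coordinates {F : fieldType} {P : falgType F} {phi : {scalar P}}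
    (phi_sym : symmetric_function phi) {W : lmodType P^c}
    {N : nat} {u : 'I_N -> W} {a : 'I_N -> {linear W -> (P^c)^o}}
    (ua_coord : coordinate_system u a)
    {I : finType} (v : I -> W) (b : I -> {linear W -> (P^c)^o})
    (vb_coord : forall w, w = \sum_p ract (v p) (b p w))
    (alpha : {linear W -> W}) :
  phi_mod phi u a alpha = \sum_p phi (b p (alpha (v p))).
Proof.
have phi_sum (g : {linear W -> (P^c)^o}) (J : finType) (w : J -> W) :
    phi (g (\sum_j w j)) = \sum_j phi (g (w j)).
  by rewrite (linear_sum g); exact: (linear_sum phi).
rewrite /phi_mod (linear_sum phi).
have expand l : phi (a l (alpha (u l))) =
    \sum_p phi (b p (ract (u l) (a l (alpha (v p)) : P))).
  rewrite [in LHS](vb_coord (u l)) (linear_sum alpha) phi_sum.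
  apply: eq_bigr => p _; rewrite !linear_ract.
  exact: phi_sym.
rewrite (eq_bigr _ (fun l _ => expand l)) exchange_big /=.
apply: eq_bigr => p _.
by rewrite [in RHS](ua_coord (alpha (v p))) phi_sum.
Qed.

Section DsumCoordinates.
Context {F : fieldType} {P : falgType F} {k : nat}.
Variables (e : 'I_k -> P) (n : 'I_k -> nat).

(** The values are taken in all of [P] rather than in [e_i P], because the coordinate functions of a
    coordinate system are maps into [P]. *)
Definition dsum_coord (p : {i : 'I_k & 'I_(n i)}) (x : dsum e n) : (P^c)^o :=
  dsum_val x p.

Fact dsum_coord_linear p : linear (dsum_coord p).
Proof. by move=> c x y; rewrite /dsum_coord !ffunE. Qed.

HB.instance Definition _ p :=
  GRing.isLinear.Build P^c (dsum e n) (P^c)^o _ (dsum_coord p)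
    (dsum_coord_linear p).

Definition dsum_basis (p : {i : 'I_k & 'I_(n i)}) : dsum e n :=
  dsum_gen e (tagged p).

Lemma dsum_coord_basis p q :
  dsum_coord q (dsum_basis p) = if q == p then e (tag q) else 0.
Proof. by rewrite /dsum_coord /= ffunE; case: p. Qed.

Hypothesis e_idem : forall i, idempotent_elt (e i).

Lemma dsum_coord_corner p x : e (tag p) * dsum_coord p x = dsum_coord p x.
Proof.
have /forallP/(_ p) : mem_dsum e (dsum_val x) by case: x.
rewrite -/(dsum_coord p x).
(* Membership in [e_i P] is membership in a span of products; it is first brought to the form
   [e_i z], on which the idempotent acts trivially. *)
suff /subvP/[apply] : (<[e (tag p)]> * fullv <= limg (amull (e (tag p))))%VS.
  by case/memv_imgP => z _ ->; rewrite lfunE /= mulrA e_idem.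
apply/prodvP => _ y /vlineP[c ->] _.
rewrite -scalerAl scalerAr -[_ * _](lfunE (e (tag p) \*o idfun)).
by rewrite memv_img ?memvf.
Qed.

(** The generators need not be free: the one at [p] is killed by every [z] with [e (tag p) * z = 0].
    Hence a coefficient is recovered only up to left multiplication by the idempotent. *)
Lemma dsum_coord_sum p (y : {i : 'I_k & 'I_(n i)} -> P) :
  dsum_coord p (\sum_q ract (dsum_basis q) (y q)) = e (tag p) * y p.
Proof.
rewrite linear_sum (bigD1 p) //= big1 ?addr0 => [|q nqp].
  by rewrite linear_ract /= dsum_coord_basis eqxx.
by rewrite linear_ract /= dsum_coord_basis eq_sym (negPf nqp) ract_regular mul0r.
Qed.

(** By linearity, this confines the coordinates of the image of a generator to a corner of [P]. *)
Lemma dsum_basis_corner p : ract (dsum_basis p) (e (tag p)) = dsum_basis p.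
Proof.
apply: val_inj; apply/ffunP => q.
suff : dsum_coord q (ract (dsum_basis p) (e (tag p))) =
  dsum_coord q (dsum_basis p) by [].
rewrite linear_ract /= dsum_coord_basis ract_regular.
by case: eqP => [->|_]; rewrite ?mul0r ?e_idem.
Qed.

Lemma dsum_coordP x : x = \sum_p ract (dsum_basis p) (dsum_coord p x).
Proof.
apply: val_inj; apply/ffunP => q.
suff : dsum_coord q x =
   dsum_coord q (\sum_p ract (dsum_basis p) (dsum_coord p x)) by [].
by rewrite dsum_coord_sum dsum_coord_corner.
Qed.

End DsumCoordinates.

Section AdaptedBasis.
Context {F : fieldType} {P : falgType F} {phi : {scalar P}}.
Context {k : nat} {e f : 'I_k -> P} {rho : 'I_k -> 'I_k -> nat -> P}.
Hypotheses (e_idem : forall i, idempotent_elt (e i))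
  (e_orth : forall i j, i != j -> e i * e j = 0)
  (rhoP : adapted_basis phi e f rho).

Lemma mem_admissible_last i : (cartan_dim e i i).+1 \in admissible e i i.
Proof. by rewrite /admissible eqxx mem_index_iota ltnS leqnn. Qed.

Lemma adapted_mull i j r : r \in admissible e i j ->
  e i * rho i j r = rho i j r.
Proof. by move/(adapted_corner rhoP) => <-; rewrite !mulrA e_idem. Qed.

(** Right multiplication by [e i] fixes [rho i i r], and [e i] is [rho i i 0], the dual partner of
    the last element; so the value of [phi] is a value of the pairing. *)
Lemma phi_adapted i r : r \in admissible e i i ->
  phi (rho i i r) = (r == (cartan_dim e i i).+1)%:R.
Proof.
move=> ri; have := adapted_pairing rhoP ri (mem_admissible_last i).
rewrite subnn (adapted_first rhoP) !eqxx /= => <-.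
by rewrite -{2}(adapted_corner rhoP ri) -mulrA e_idem (adapted_corner rhoP).
Qed.

(** Each element of [Omega] lies in a single Peirce corner, so multiplying a full expansion by [e s]
    on the left and [e i] on the right keeps only the terms of the corner [(s, i)]. *)
Lemma corner_expansion s i (y : P) : e s * y * e i = y ->
  exists c : nat -> F, y = \sum_(r <- admissible e s i) c r *: rho s i r.
Proof.
move=> <-; set z := e s * y * e i.
have := memvf z; rewrite -(span_basis (adapted_basisP rhoP)).
have /andP[_ free_rho] := adapted_basisP rhoP.
(* The coefficients come indexed by the basis vectors themselves, whence the witness. *)
case/(free_span free_rho) => c zE _; exists (fun r => c (rho s i r)).
have -> : z = e s * z * e i by rewrite /z !mulrA e_idem -!mulrA e_idem.
rewrite [in LHS]zE /Omega big_allpairs_dep big_enum /=.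
rewrite mulr_sumr mulr_suml (bigD1 (s, i)) //= addrC big1 ?add0r => [|[a b] nab].
  rewrite mulr_sumr mulr_suml !big_seq; apply: eq_bigr => r radm.
  by rewrite -scalerAr -scalerAl (adapted_corner rhoP).
rewrite mulr_sumr mulr_suml big_seq big1 // => r radm /=.
rewrite -scalerAr -scalerAl -(adapted_corner rhoP radm).
have [eq_as|nas] := eqVneq a s; last first.
  by rewrite !mulrA (e_orth s a) 1?eq_sym // !mul0r scaler0.
have nbi : b != i by apply: contraNneq nab => ->; rewrite eq_as.
by rewrite -!mulrA (e_orth b i) // !mulr0 scaler0.
Qed.

(** Grouping the scalars attached to one generator gives it a single coefficient in [P], the form to
    which [dsum_coord_sum] applies. *)
Lemma expansionE {W : lmodType P^c} {n : 'I_k -> nat}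
    (v : forall i, 'I_(n i) -> W) i w (c : coefficients F n) :
  expansion e rho v i w c <->
  w = \sum_(q : {s : 'I_k & 'I_(n s)}) ract (v (tag q) (tagged q))
        (\sum_(r <- admissible e (tag q) i)
           c (tag q) (tagged q) r *: rho (tag q) i r).
Proof.
rewrite /expansion -(sum_tag (fun s t => ract (v s t)
  (\sum_(r <- admissible e s i) c s t r *: rho s i r))) /=.
by split=> ->; [symmetry|]; under eq_bigr do under eq_bigr do rewrite ract_sumr.
Qed.

Lemma phi_adapted_sum i (c : nat -> F) :
  phi (\sum_(r <- admissible e i i) c r *: rho i i r) =
    c (cartan_dim e i i).+1.
Proof.
rewrite (linear_sum phi) (bigD1_seq _ (mem_admissible_last i)) /=; last first.
  by rewrite /admissible eqxx iota_uniq.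
rewrite linearZ /= phi_adapted ?mem_admissible_last // eqxx mulr1.
rewrite big_seq_cond big1 ?addr0 // => r /andP[radm /negPf nr].
by rewrite linearZ /= phi_adapted // nr mulr0.
Qed.

End AdaptedBasis.

Theorem theorem3p10 (F : closedFieldType) (charF : [pchar F] =i pred0)
    (P : falgType F) (k : nat) (e : 'I_k -> P)
    (Pdec : primitive_decomposition e)
    (Pbasic : basic e)
    (Psym : symmetric_algebra P)
    (Pindec : indecomposable_algebra P)
    (phi : {scalar P})
    (phi_sym : symmetric_function phi)
    (phi_nondeg : nondegenerate_function phi)
    (phi_e : forall i, phi (e i) = 0)
    (f : 'I_k -> P) (fdual : dual_socle_basis phi e f)
    (rho : 'I_k -> 'I_k -> nat -> P) (rhoP : adapted_basis phi e f rho)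
    (W : lmodType P^c)
    (Wfg : fin_generated W) (Wproj : projective W)
    (n : 'I_k -> nat) (theta : {linear dsum e n -> W})
    (theta_iso : bijective theta)
    (N : nat) (u : 'I_N -> W) (a : 'I_N -> {linear W -> (P^c)^o})
    (ua_coord : coordinate_system u a) :
  phi_mod phi u a =1 pseudotrace rho theta.
Proof.
have [e_prim e_orth _] := Pdec.
have e_idem i : idempotent_elt (e i) by have [] := e_prim i.
have [theta' thetaK theta'K] := theta_iso.
pose theta'_lin := GRing.isLinear.Build _ _ _ _ theta'
  (can2_linear thetaK theta'K).
pose eta : {linear W -> dsum e n} := HB.pack theta' theta'_lin.
pose v p := theta (dsum_basis e n p).
pose b p : {linear W -> (P^c)^o} := dsum_coord e n p \o eta.
have vb_coord w : w = \sum_p ract (v p) (b p w).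
  rewrite -{1}(theta'K w) {1}(dsum_coordP _ _ e_idem (theta' w)) linear_sum.
  by apply: eq_bigr => p _; rewrite linear_ract.
move=> alpha; rewrite (phi_mod_coordinates phi_sym ua_coord v b vb_coord).
rewrite /pseudotrace; set vgen := fun i j => theta (dsum_gen e j).
rewrite (sum_tag (fun i j =>
  coef_of e rho vgen i (alpha (vgen i j)) j (cartan_dim e i i).+1)) /=.
apply: eq_bigr => p _; set i := tag p; set w := alpha (v p).
transitivity (phi (b p w)); first by [].
(* The left factor is absorbed because the coordinate lies in [e (tag q) P], the right one because
   [alpha (v p)] inherits [v p * e i = v p]. *)
have corner q : e (tag q) * b q w * e i = b q w.
  rewrite (dsum_coord_corner e n e_idem) -ract_regular -!linear_ract.
  by rewrite /v dsum_basis_corner.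
have [C CE] := fin_all_exists (fun q =>
  corner_expansion e_idem e_orth rhoP _ _ _ (corner q)).
(* [coef_of] is an epsilon choice, so some expansion must be exhibited. Afterwards only the
   expansion property of the chosen [c] is used: [phi] reads the same value off any expansion. *)
have : expansion e rho vgen i w (coef_of e rho vgen i w).
  apply: epsilon_spec; exists (fun s t => C (Tagged _ t)).
  apply/expansionE; rewrite [LHS]vb_coord; apply: eq_bigr => q _.
  by rewrite [in LHS]CE; case: q.
set c := coef_of e rho vgen i w => /expansionE wE.
have -> : b p w =
    e i * \sum_(r <- admissible e i i) c i (tagged p) r *: rho i i r.
  rewrite -(dsum_coord_sum e n p (fun q => \sum_(r <- admissible e (tag q) i)
    c (tag q) (tagged q) r *: rho (tag q) i r)).
  congr dsum_coord; apply: (can_inj thetaK).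
  rewrite theta'K linear_sum wE; apply: eq_bigr => q _.
  by rewrite linear_ract.
(* The [f_i]-coefficient is rewritten as a value of [phi]; the extra factor [e i] then disappears,
   since it fixes every [rho i i r]. *)
rewrite -[RHS](phi_adapted_sum e_idem rhoP i (c i (tagged p))) mulr_sumr.
congr (phi _); rewrite !big_seq; apply: eq_bigr => r radm.
by rewrite -scalerAr (adapted_mull e_idem rhoP).
Qed.
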